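(* Let $\{r_n\}_{n \in \mathbb{N}} \subset \mathbb{N}$ be lacunary and let $\{t_n\}_{n \in \mathbb{N}} \subset \mathbb{N}$, with $t_1 < t_2 < \cdots$, be such that $\lim_{n \to \infty} t_n/r_n = 0$. Then $E = \{r_n\}_{n \in \mathbb{N}} \cup \{r_n + t_n\}_{n \in \mathbb{N}}$ is an $I_0$-set if and only if $\{t_n\}_{n \in \mathbb{N}}$ is not a set of Bohr recurrence.
   Context: $\mathbb{N} = \{1,2,3,\ldots\}$ and $\mathbb{T} = \mathbb{R}/\mathbb{Z}$. A set $\{r_n\}_{n\in\mathbb{N}} \subset \mathbb{N}$ with $r_1 < r_2 < \cdots$ is lacunary if $\inf_{n \in \mathbb{N}} r_{n+1}/r_n > 1$. A Bohr almost periodic sequence is a uniform limit on $\mathbb{N}$ of trigonometric polynomials, i.e. of functions of the form $n \mapsto \sum_{j=1}^{k} c_j e^{2\pi i n \alpha_j}$ with $c_j \in \mathbb{C}$, $\alpha_j \in \mathbb{R}$. A set $E \subset \mathbb{N}$ is an $I_0$-set if every bounded function $f : E \to \mathbb{C}$ can be extended to a Bohr almost periodic sequence on $\mathbb{N}$. A set $R \subset \mathbb{N}$ is a set of Bohr recurrence if and only if for every finite-dimensional torus $\mathbb{T}^d$ and every $\alpha \in \mathbb{T}^d$, the point $0$ is in the closure of $\{n\alpha : n \in R\}$. *)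

(* Defs.v *)
From HB Require Import structures.
From mathcomp Require Import all_boot all_order all_algebra ring_quotient.
From mathcomp Require Import archimedean.
From mathcomp Require Import all_classical all_reals all_analysis.
From mathcomp Require Import complex.

Set Implicit Arguments.
Unset Strict Implicit.
Unset Printing Implicit Defensive.

Import Order.TTheory GRing.Theory Num.Theory.
Import numFieldNormedType.Exports.

Local Open Scope classical_set_scope.
Local Open Scope ring_scope.

(* The natural numbers of the paper start at 1: its subsets of N are sets of
   positive elements of nat, the value at 0 of a function on nat is irrelevant,
   and a sequence x_1, x_2, ... is encoded as x : nat -> nat with x n in the
   role of x_(n+1).  Complex numbers carry the norm topology through the
   regular alias R[i]^o. *)

Definition lacunary (R : realType) (r : nat -> nat) : Prop :=
  {homo r : m n / (m < n)%N} /\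
  1 < inf (range (fun n => (r n.+1)%:R / (r n)%:R : R)).

Definition expi (R : realType) (x : R) : R[i] := (cos x +i* sin x)%C.

Definition trigonometric_polynomial (R : realType) (p : nat -> R[i]^o) : Prop :=
  exists (k : nat) (c : 'I_k -> R[i]) (alpha : 'I_k -> R), forall n : nat,
    p n = \sum_(j < k) c j * expi (2 * pi * n%:R * alpha j).

Definition bohr_almost_periodic (R : realType) (f : nat -> R[i]^o) : Prop :=
  exists p : nat -> nat -> R[i]^o,
    (forall k, trigonometric_polynomial (p k)) /\
    {uniform [set n : nat | (0 < n)%N], p @ \oo --> f}.

(* A function on E is given by (any) values on nat, of which only the
   restriction to E is used. *)
Definition I0_set (R : realType) (E : set nat) : Prop :=
  forall f : nat -> R[i]^o, [bounded f n | n in E] ->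
    exists g : nat -> R[i]^o,
      bohr_almost_periodic g /\ (forall n, E n -> g n = f n).

(* The subgroup Z of R, and T = R/Z with its quotient group structure and
   quotient topology. *)
Definition integers (R : realType) : zmodClosed R :=
  Algebra.ZmodClosed.clone R (@Num.int_num_subdef R) _.

Definition torus (R : realType) : Type :=
  quotient_topology (Quotient.quot (integers R)).

HB.instance Definition _ (R : realType) := Topological.on (torus R).
HB.instance Definition _ (R : realType) := Algebra.isZmodule.Build (torus R)
  (@Quotient.addqA R (integers R)) (@Quotient.addqC R (integers R))
  (@Quotient.add0q R (integers R)) (@Quotient.addNq R (integers R)).

(* Row vectors over the torus carry the product topology. *)
Definition bohr_recurrent (R : realType) (S : set nat) : Prop :=
  forall (d : nat) (alpha : 'rV[torus R]_d),
    closure [set alpha *+ n | n in S] 0.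

(* Main.v *)
Require Import Defs.
From mathcomp Require Import all_boot all_order all_algebra.
From mathcomp Require Import archimedean ring_quotient.
From mathcomp Require Import all_classical all_reals all_analysis.
From mathcomp Require Import complex ring lra.
Set Implicit Arguments.
Unset Strict Implicit.
Unset Printing Implicit Defensive.
Import Order.TTheory GRing.Theory Num.Theory.
Import numFieldNormedType.Exports.
Local Open Scope classical_set_scope.
Local Open Scope ring_scope.

(** The theorem holds because interpolation by almost periodic sequences is a
    matter of separation.  Call two sets of integers separated if a real
    trigonometric polynomial is at most a on the first one and at least b > a
    on the second one.  Separation is symmetric and stable under finite unions
    (trig_sepUr), because composing with polynomials enlarges any gap to a
    fixed size (trig_sep_amplify).  If all pairs of disjoint subsets of E are
    separated then E is an I_0-set (I0_of_separated): as in Tietze's extension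
    theorem, one trigonometric polynomial reduces the error on E by a factor
    5/6 while its own size is controlled everywhere, and the resulting series
    converges uniformly.

    Disjoint subsets A, B of a lacunary set are separated
    (lacunary_separated).  When all ratios are at least 8, nested intervals
    (lacunary_dilation) produce a real be such that n * be is near 0 modulo 1
    for n in A and near 1/2 for n in B.  For smaller ratios, splitting A and B
    into finitely many pieces leaves pairs whose pieces are very sparse, but
    where an element of B can follow an element of A closely.  Then n * be is
    prescribed for n in A only, to be near 0 or 1/32, the choice being made so
    that the close successor of n in B avoids both values (dilate_avoids).

    Now let E consist of the r n and r n + t n.  If {t n} is not a set of Bohr
    recurrence, there are finitely many reals a j such that each t n * a j0 is
    far from 0 modulo 1 for some j0.  A set that contains at most one of r n
    and r n + t n for each n is lacunary up to finitely many elements, so the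
    only problem is to separate {r n} from {r n + t n} (shift_separated).
    Modulo 1, sort the r m * a j into small boxes.  The r n that share the box
    of r m are separated from r m + t m by the frequency a j, and the other
    r n form a lacunary set with the r m + t m.

    Conversely, if {t n} is a set of Bohr recurrence, every trigonometric
    polynomial has arbitrarily large almost periods t n (trig_poly_recurrent),
    hence no almost periodic sequence can be 0 at all r n and 1 at all but
    finitely many r n + t n. *)

(** * Cosine and the distance to the integers *)

Definition near_int (R : realType) (d u : R) :=
  exists k : int, `|u - k%:~R| <= d.

Definition far_int (R : realType) (d u : R) :=
  forall k : int, d <= `|u - k%:~R|.

Lemma cos_addz (R : realType) (u : R) (k : int) :
  cos (2 * pi * (u + k%:~R)) = cos (2 * pi * u).
Proof.
have cos_addn v n : cos (2 * pi * (v + n%:R)) = cos (2 * pi * v) :> R.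
  elim: n v => [|n IHn] v; first by rewrite addr0.
  rewrite -(IHn v) -[RHS]cosD2pi; congr cos.
  by rewrite -natr1 mulr2n; ring.
case: k => n; first exact: cos_addn.
rewrite NegzE -[in RHS](subrK n.+1%:R u) cos_addn.
by rewrite mulrNz.
Qed.

Lemma cos2pi_lt (R : realType) (x y : R) :
  0 <= x -> x < y -> y <= 2^-1 -> cos (2 * pi * y) < cos (2 * pi * x).
Proof.
move=> x0 xy y2; have p0 := pi_gt0 R.
rewrite ltr_cos ?in_itv /=; first by rewrite ltr_pM2l//; nra.
  by apply/andP; split; nra.
by apply/andP; split; nra.
Qed.

Lemma cos2pi_le (R : realType) (x y : R) :
  0 <= x -> x <= y -> y <= 2^-1 -> cos (2 * pi * y) <= cos (2 * pi * x).
Proof.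
rewrite [x <= y]le_eqVlt => x0 /predU1P[->//|xy] y2.
exact/ltW/cos2pi_lt.
Qed.

Lemma near_int_cos (R : realType) (d u : R) :
  d <= 2^-1 -> near_int d u -> cos (2 * pi * d) <= cos (2 * pi * u).
Proof.
move=> d2 [k ukd]; rewrite -[u](subrK k%:~R) cos_addz.
have -> : cos (2 * pi * (u - k%:~R)) = cos (2 * pi * `|u - k%:~R|).
  by case: ger0P => // _; rewrite mulrN cosN.
exact: cos2pi_le.
Qed.

Lemma far_int_cos (R : realType) (d u : R) :
  0 <= d -> d <= 2^-1 -> far_int d u -> cos (2 * pi * u) <= cos (2 * pi * d).
Proof.
move=> d0 d2 uf.
have /andP[] := floor_itv u; set k := Num.Def.floor u => ku uk.
have := uf k; have := uf (k + 1); rewrite intrD in uk *.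
rewrite distrC !ger0_norm ?subr_ge0//; last exact/ltW.
move=> h1 h2; rewrite -[u](subrK k%:~R) cos_addz.
have [le2|gt2] := leP (u - k%:~R) 2^-1; first exact: cos2pi_le.
have -> : cos (2 * pi * (u - k%:~R)) = cos (2 * pi * (k%:~R + 1 - u)).
  by rewrite -[RHS](cos_addz _ (-1)) -[RHS]cosN; congr cos; ring.
by apply: cos2pi_le => //; lra.
Qed.

(** * Real trigonometric polynomials *)

(** Sequences of coefficient-frequency pairs make sums and products of
    trigonometric polynomials concatenations and lists of pairs. *)
Lemma trigonometric_polynomial_seq (R : realType) (p : nat -> R[i]^o) :
  trigonometric_polynomial p <->
  exists s : seq (R[i] * R), forall n,
    p n = \sum_(x <- s) x.1 * expi (2 * pi * n%:R * x.2).
Proof.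
split=> [[k [c [a pE]]]|[s pE]].
  exists [seq (c j, a j) | j <- enum 'I_k] => n.
  by rewrite pE big_map big_enum.
exists (size s), (fun j => (tnth (in_tuple s) j).1),
  (fun j => (tnth (in_tuple s) j).2) => n.
by rewrite pE big_tnth.
Qed.

Lemma expiD (R : realType) (x y : R) : expi (x + y) = expi x * expi y.
Proof.
rewrite /expi cosD sinD; simpc.
by congr (_ +i* _)%C; rewrite addrC (mulrC (sin x)).
Qed.

Lemma norm_expi (R : realType) (x : R) : `|expi x| = 1.
Proof. by rewrite normc_def /= cos2Dsin2 sqrtr1. Qed.

Definition real_trig_poly (R : realType) (P : nat -> R) :=
  trigonometric_polynomial (fun n => (P n)%:C%C : R[i]^o).

Section RealTrigPoly.
Context {R : realType}.
Implicit Types (P Q : nat -> R).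

Lemma trigpD (p q : nat -> R[i]^o) :
  trigonometric_polynomial p -> trigonometric_polynomial q ->
  trigonometric_polynomial (fun n => p n + q n : R[i]^o).
Proof.
move=> /trigonometric_polynomial_seq[s pE].
move=> /trigonometric_polynomial_seq[s' qE].
apply/trigonometric_polynomial_seq; exists (s ++ s') => n.
by rewrite big_cat /= pE qE.
Qed.

Lemma trigpM (p q : nat -> R[i]^o) :
  trigonometric_polynomial p -> trigonometric_polynomial q ->
  trigonometric_polynomial (fun n => (p n : R[i]) * q n : R[i]^o).
Proof.
move=> /trigonometric_polynomial_seq[s pE].
move=> /trigonometric_polynomial_seq[s' qE].
apply/trigonometric_polynomial_seq.
exists [seq (x.1 * y.1, x.2 + y.2) | x <- s, y <- s'] => n.
rewrite big_allpairs_dep pE qE mulr_suml; apply: eq_bigr => x _.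
rewrite mulr_sumr; apply: eq_bigr => y _ /=.
by rewrite [in RHS](mulrDr (2 * pi * n%:R)) expiD mulrACA.
Qed.

Lemma trigpC (c : R[i]) : trigonometric_polynomial (fun=> c : R[i]^o).
Proof.
apply/trigonometric_polynomial_seq; exists [:: (c, 0)] => n.
by rewrite big_seq1 /= mulr0 /expi cos0 sin0 mulr1.
Qed.

Lemma rtrigpC (c : R) : real_trig_poly (fun=> c).
Proof. exact: trigpC. Qed.

Lemma rtrigpD P Q : real_trig_poly P -> real_trig_poly Q ->
  real_trig_poly (fun n => P n + Q n).
Proof.
move=> hP hQ; rewrite /real_trig_poly.
under eq_fun do rewrite rmorphD /=.
exact: trigpD.
Qed.

Lemma rtrigpM P Q : real_trig_poly P -> real_trig_poly Q ->
  real_trig_poly (fun n => P n * Q n).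
Proof.
move=> hP hQ; rewrite /real_trig_poly.
under eq_fun do rewrite rmorphM /=.
exact: trigpM.
Qed.

Lemma rtrigp_cos (a th : R) :
  real_trig_poly (fun n => cos (2 * pi * (n%:R * a - th))).
Proof.
apply/trigonometric_polynomial_seq.
exists [:: (2^-1 * expi (- (2 * pi * th)), a);
  (2^-1 * expi (2 * pi * th), - a)].
move=> n; rewrite big_cons big_seq1 /= -!mulrA -!expiD.
set u := 2 * pi * (n%:R * a - th).
have -> : - (2 * (pi * th)) + 2 * (pi * (n%:R * a)) = u by rewrite /u; ring.
have -> : 2 * (pi * th) + 2 * (pi * (n%:R * - a)) = - u by rewrite /u; ring.
rewrite -mulrDr /expi cosN sinN; simpc.
rewrite mulrA -/u -complexr0; congr (_ +i* _)%C.
by rewrite expr0n addr0; field.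
Qed.

Lemma rtrigp_bounded P : real_trig_poly P ->
  exists2 M, 0 < M & forall n, `|P n| <= M.
Proof.
move=> /trigonometric_polynomial_seq[s pE].
exists (1 + \sum_(x <- s) complex.Re `|x.1|).
  apply: ltr_wpDr => //; apply: sumr_ge0 => x _.
  by rewrite normc_def /= sqrtr_ge0.
move=> n; rewrite -lecR (le_trans (y := `|(P n)%:C%C|))//.
  by rewrite normc_def /= expr0n addr0 sqrtr_sqr.
rewrite pE (le_trans (ler_norm_sum _ _ _))//.
rewrite rmorphD rmorph_sum /= ler_wpDl ?lec01//.
apply: ler_sum => x _; rewrite normrM norm_expi mulr1.
exact: lexx.
Qed.

End RealTrigPoly.

(** * Separation by trigonometric polynomials *)

Section Separation.
Context {R : realType}.
Implicit Types (P Q : nat -> R) (A B C : set nat).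

(** The thresholds are arbitrary, so that any estimate on a single cosine gives
    separation; trig_sep_amplify normalizes them. *)
Definition trig_sep A B := exists P, real_trig_poly P /\
  exists a b : R,
    [/\ a < b, forall n, A n -> P n <= a & forall n, B n -> b <= P n].

Lemma trig_sep_sym A B : trig_sep A B -> trig_sep B A.
Proof.
move=> [P [hP [a [b [ab hA hB]]]]]; exists (fun n => -1 * P n); split.
  by apply: rtrigpM => //; exact: rtrigpC.
exists (- b), (- a); rewrite ltrN2; split=> // n hn; rewrite mulN1r lerN2.
  exact: hB.
exact: hA.
Qed.

Lemma trig_sepS A B A' B' : A' `<=` A -> B' `<=` B ->
  trig_sep A B -> trig_sep A' B'.
Proof.
move=> sA sB [P [hP [a [b [ab hA hB]]]]]; exists P; split=> //.
by exists a, b; split=> // n hn; [apply/hA/sA | apply/hB/sB].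
Qed.

Let steepen (x : R) := 2^-1 * x * (3 - x * x).

Let steepenN x : steepen (- x) = - steepen x.
Proof. by rewrite /steepen; ring. Qed.

Let steepen_itv x : `|x| <= 1 -> `|steepen x| <= 1.
Proof.
rewrite !ler_norml => /andP[x0 x1]; rewrite /steepen.
have h1 : 0 <= (1 - x) ^+ 2 * (2 + x) by rewrite mulr_ge0 ?sqr_ge0//; lra.
have h2 : 0 <= (1 + x) ^+ 2 * (2 - x) by rewrite mulr_ge0 ?sqr_ge0//; lra.
by apply/andP; split; lra.
Qed.

Let iter_steepenN k x : iter k steepen (- x) = - iter k steepen x.
Proof. by elim: k => //= k ->; rewrite steepenN. Qed.

Let iter_steepen k e x : 0 < e -> e <= x -> x <= 1 ->
  iter k steepen x <= 1 /\
  (2^-1 <= iter k steepen x \/ e + k%:R * (e / 4) <= iter k steepen x).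
Proof.
move=> e0 ex x1; elim: k => [|k [IH1 IH2]] /=.
  by split => //; right; rewrite mul0r addr0.
set y := iter k steepen x in IH1 IH2 *.
have k0 : 0 <= k%:R * (e / 4) by rewrite mulr_ge0 ?ler0n// divr_ge0 ?ltW.
have y0 : 0 < y by case: IH2 => h; [lra | lra].
split.
  have /steepen_itv : `|y| <= 1 by rewrite gtr0_norm.
  by rewrite ler_norml => /andP[].
have hy : steepen y = y + 2^-1 * y * (1 - y * y) by rewrite /steepen; field.
have [y2|y2] := leP 2^-1 y.
  have hp : 0 <= y * (1 - y * y) by nra.
  by left; rewrite hy; lra.
right; case: IH2 => [|IH2]; first lra.
rewrite hy -natr1 mulrDl mul1r addrA lerD//.
have : y * y <= 4^-1 by nra.
have : e <= y by lra.
nra.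
Qed.

(** Polynomials act on trigonometric polynomials, and iterating the odd cubic
    3x/2 - x^3/2 of [-1, 1] into itself pushes every point away from 0 towards
    1 or -1: however small the gap of a separating function, another one has
    a gap of fixed size between fixed bounds. *)
Lemma trig_sep_amplify A B : trig_sep A B ->
  exists P, [/\ real_trig_poly P, forall n, 0 <= P n <= 1,
    forall n, A n -> P n <= 1 / 4 & forall n, B n -> 3 / 4 <= P n].
Proof.
move=> [P [hP [a [b [ab hA hB]]]]].
pose c := (a + b) / 2.
have [M M0 hM] := rtrigp_bounded (rtrigpD hP (rtrigpC (- c))).
pose Q0 n := (P n - c) * M^-1.
have Q01 n : `|Q0 n| <= 1.
  by rewrite normrM normfV (gtr0_norm M0) ler_pdivrMr// mul1r hM.
pose e := (b - a) / 2 * M^-1.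
have e0 : 0 < e by rewrite /e mulr_gt0 ?invr_gt0//; lra.
have [k ke] : exists k, 2^-1 <= e + k%:R * (e / 4).
  exists (Num.truncn (2^-1 / (e / 4))).+1.
  have e4 : 0 < e / 4 by lra.
  rewrite ler_wpDl ?(ltW e0)// -ler_pdivrMr//.
  exact/ltW/truncnS_gt.
pose Q n := iter k steepen (Q0 n).
have hQ : real_trig_poly Q.
  suff hQm m : real_trig_poly (fun n => iter m steepen (Q0 n)) by exact: hQm.
  elim: m => [|m IH] /=.
    by apply: rtrigpM (rtrigpC _); apply: rtrigpD (rtrigpC _).
  apply: rtrigpM; first by apply: rtrigpM => //; exact: rtrigpC.
  apply: rtrigpD; first exact: rtrigpC.
  under eq_fun do rewrite -mulN1r.
  by apply: rtrigpM; [exact: rtrigpC | exact: rtrigpM].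
have Q1 n : `|Q n| <= 1.
  suff Qm m : `|iter m steepen (Q0 n)| <= 1 by exact: Qm.
  by elim: m => //= m; exact: steepen_itv.
exists (fun n => (Q n + 1) * 2^-1); split.
- by apply: rtrigpM (rtrigpC _); apply: rtrigpD (rtrigpC _).
- by move=> n; have := Q1 n; rewrite ler_norml => /andP[]; lra.
- move=> n /hA Pn; have en : e <= - Q0 n.
    by rewrite /e /Q0 -mulNr ler_wpM2r ?invr_ge0 ?(ltW M0)// /c; lra.
  have n1 : - Q0 n <= 1 by have := Q01 n; rewrite ler_norml => /andP[]; lra.
  have [_] := iter_steepen k e0 en n1; rewrite iter_steepenN -/(Q n) => h.
  by case: h; lra.
- move=> n /hB Pn; have en : e <= Q0 n.
    by rewrite /e /Q0 ler_wpM2r ?invr_ge0 ?(ltW M0)// /c; lra.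
  have n1 : Q0 n <= 1 by have := Q01 n; rewrite ler_norml => /andP[]; lra.
  have [_] := iter_steepen k e0 en n1; rewrite -/(Q n) => h.
  by case: h; lra.
Qed.

Lemma trig_sepUr A B C : trig_sep A B -> trig_sep A C -> trig_sep A (B `|` C).
Proof.
move=> /trig_sep_amplify[P [hP P01 PA PB]].
move=> /trig_sep_amplify[Q [hQ Q01 QA QC]].
(* the complement of the product of complements is a smooth maximum *)
exists (fun n => P n + (1 + (-1) * P n) * Q n); split.
  apply: rtrigpD => //; apply: rtrigpM => //; apply: rtrigpD.
    exact: rtrigpC.
  by apply: rtrigpM => //; exact: rtrigpC.
exists (7 / 16), (3 / 4); split; first lra.
  move=> n An; have := PA _ An; have := QA _ An.
  by have /andP[] := P01 n; have /andP[] := Q01 n; nra.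
move=> n BCn; have /andP[? ?] := P01 n; have /andP[? ?] := Q01 n.
by case: BCn => [/PB|/QC] ?; nra.
Qed.

Lemma trig_sep_set0 A : trig_sep A set0.
Proof.
exists (fun=> 0); split; first exact: rtrigpC.
by exists 0, 1; split.
Qed.

Lemma trig_sep_bigUr (I : eqType) (s : seq I) A (B : I -> set nat) :
  (forall i, trig_sep A (B i)) ->
  trig_sep A [set n | exists2 i, i \in s & B i n].
Proof.
move=> h; elim: s => [|i s IH].
  by apply: trig_sepS (trig_sep_set0 A) => // n [].
apply: trig_sepS (trig_sepUr (h i) IH) => // n [j +].
by rewrite in_cons => /predU1P[-> hn|js hn]; [left | right; exists j].
Qed.

Lemma trig_sepUl A B C : trig_sep A C -> trig_sep B C -> trig_sep (A `|` B) C.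
Proof.
by move=> /trig_sep_sym h1 /trig_sep_sym h2; apply/trig_sep_sym/trig_sepUr.
Qed.

Lemma trig_sep_bigUl (I : eqType) (s : seq I) (A : I -> set nat) B :
  (forall i, trig_sep (A i) B) ->
  trig_sep [set n | exists2 i, i \in s & A i n] B.
Proof.
by move=> h; apply/trig_sep_sym/trig_sep_bigUr => i; exact/trig_sep_sym.
Qed.

(** The form in which all separations arise: one frequency al, seen from the
    point th of the circle. *)
Lemma trig_sep_near_far (al th d1 d2 : R) A B :
  0 <= d1 -> d1 < d2 -> d1 < 2^-1 ->
  (forall n, A n -> near_int d1 (n%:R * al - th)) ->
  (forall n, B n -> far_int d2 (n%:R * al - th)) ->
  trig_sep A B.
Proof.
move=> d10 d12 d1h hA hB; apply: trig_sep_sym.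
exists (fun n => cos (2 * pi * (n%:R * al - th))); split.
  exact: rtrigp_cos.
(* far_int d2 is void for d2 > 1/2, where cos2pi_lt stops applying *)
pose d := Num.min d2 2^-1.
have dh : d <= 2^-1 by rewrite /d ge_min lexx orbT.
have d1d : d1 < d by rewrite /d lt_min d12.
exists (cos (2 * pi * d)), (cos (2 * pi * d1)); split.
- exact: cos2pi_lt.
- move=> n Bn; apply: far_int_cos => //; first lra.
  by move=> k; apply: le_trans (hB n Bn k); rewrite /d ge_min lexx.
- by move=> n An; apply: near_int_cos; [lra | exact: hA].
Qed.

End Separation.
Arguments trig_sep : clear implicits.

(** * Dilations of sparse sets modulo 1 *)

Section Lacunary.
Context {R : realType}.
Implicit Types X : set nat.

Lemma nested_intervals_point (a b : nat -> R) :
  (forall n, a n <= a n.+1) -> (forall n, b n.+1 <= b n) ->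
  (forall n, a n <= b n) -> exists x, forall n, a n <= x <= b n.
Proof.
move=> a_incr b_decr ab.
have /nondecreasing_seqP a_mono := a_incr.
have /nonincreasing_seqP b_mono := b_decr.
have a_le_b m n : a m <= b n.
  apply: le_trans (le_trans (ab (maxn m n)) _).
    exact/a_mono/leq_maxl.
  exact/b_mono/leq_maxr.
exists (sup (range a)) => n; apply/andP; split.
  apply: ub_le_sup; last by exists n.
  by exists (b 0%N) => _ [m _ <-].
apply: ge_sup; first by exists (a 0%N), 0%N.
by move=> _ [m _ <-].
Qed.

(** For subsets of nat this is lacunarity with a given ratio, without reference
    to an enumeration, so that it passes to subsets. *)
Definition lacunary_set (q : R) X :=
  forall x y, X x -> X y -> (x < y)%N -> q * x%:R <= y%:R.

Lemma lacunary_setS q X Y : Y `<=` X -> lacunary_set q X -> lacunary_set q Y.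
Proof. by move=> sYX h x y /sYX ? /sYX; exact: h. Qed.

(** Nested intervals: the constraint at x confines the dilation to an interval
    of length l / x, which at the scale of the next element y of X is at least
    L / y long, hence leaves room for the constraint at y. *)
Lemma lacunary_dilation X (G : nat -> set R) (L l W : R) :
  0 <= L -> 0 <= l -> L <= W * l -> lacunary_set W X ->
  (forall x, X x -> (0 < x)%N) ->
  (forall x, X x -> forall u, exists v,
    [/\ u <= v, v + l <= u + L & forall w, v <= w <= v + l -> G x w]) ->
  exists be, forall x, X x -> G x (x%:R * be).
Proof.
move=> L0 l0 LWl lacX X0 hG.
have /boolp.choice[pick pickP] : forall xu : nat * R, exists v, X xu.1 ->
    [/\ xu.2 <= v, v + l <= xu.2 + L & forall w, v <= w <= v + l -> G xu.1 w].
  move=> [x u] /=.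
  have [/hG/(_ u)[v hv]|nX] := pselect (X x); last by exists 0.
  by exists v.
pose step (n : nat) (I : R * R) := if `[< X n >]
  then (pick (n, n%:R * I.1) / n%:R, l / n%:R) else I.
(* an interval is represented by its left end and its length *)
pose I := fix I n := if n is m.+1 then step m (I m) else (0, L) : R * R.
have I_long n : 0 <= (I n).2 /\
    forall x, X x -> (n <= x)%N -> L <= (I n).2 * x%:R.
  elim: n => [|n [IH0 IH]] /=.
    by split=> // x /X0 x0 _; rewrite ler_peMr// ler1n.
  rewrite /step; case: asboolP => [Xn|_] /=; last first.
    by split=> // x Xx nx; apply: IH => //; exact: ltnW.
  have n0 : 0 < n%:R :> R by rewrite ltr0n X0.
  split; first by rewrite divr_ge0 ?ler0n.
  move=> x Xx nx; rewrite (le_trans LWl)// mulrAC ler_pdivlMr//.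
  by rewrite mulrAC (mulrC l) ler_wpM2r// lacX.
have I_step n : X n ->
    [/\ n%:R * (I n).1 <= n%:R * (I n.+1).1,
        n%:R * ((I n.+1).1 + (I n.+1).2) <= n%:R * ((I n).1 + (I n).2) &
        forall w, (I n.+1).1 <= w <= (I n.+1).1 + (I n.+1).2 -> G n (n%:R * w)].
  move=> Xn; have n0 : 0 < n%:R :> R by rewrite ltr0n X0.
  have [_ /(_ n Xn (leqnn n))] := I_long n.
  rewrite /= /step asboolT//=.
  have [/= h1 h2 h3] := pickP (n, n%:R * (I n).1) Xn.
  move=> hL; rewrite !mulrDr mulrCA divff ?gt_eqF// mulr1.
  rewrite [n%:R * (l / _)]mulrCA divff ?gt_eqF// mulr1; split=> //.
    by apply: le_trans h2 _; rewrite lerD2l mulrC.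
  move=> w; rewrite -mulrDl ler_pdivrMr// ler_pdivlMr// => hw.
  by rewrite mulrC; exact: h3.
have I_stay n : ~ X n -> I n.+1 = I n by move=> nX; rewrite /= /step asboolF.
have [|||be hbe] := @nested_intervals_point (fun n => (I n).1)
    (fun n => (I n).1 + (I n).2).
- move=> n; have [Xn|/I_stay->//] := pselect (X n).
  have n0 : 0 < n%:R :> R by rewrite ltr0n X0.
  by have [+ _ _] := I_step n Xn; rewrite ler_pM2l.
- move=> n; have [Xn|/I_stay->//] := pselect (X n).
  have n0 : 0 < n%:R :> R by rewrite ltr0n X0.
  by have [_ + _] := I_step n Xn; rewrite ler_pM2l.
- by move=> n; rewrite lerDl; have [] := I_long n.
exists be => x Xx; have [_ _] := I_step x Xx; apply; exact: hbe.
Qed.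

End Lacunary.

(** * Separation of disjoint subsets of a lacunary set *)

Section LacunarySeparation.
Context {R : realType}.
Implicit Types (S A B X : set nat).

Lemma int_gap (m k : int) : m%:~R <= k%:~R :> R \/ k%:~R + 1 <= m%:~R :> R.
Proof.
have [mk|km] := leP m k; [left | right]; first by rewrite ler_int.
by rewrite -(intrD _ k 1) ler_int lezD1.
Qed.

Lemma int_above (u : R) : exists k : int, u <= k%:~R <= u + 1.
Proof.
exists (Num.floor u + 1); have /andP[h1 h2] := floor_itv u.
by rewrite (ltW h2) intrD lerD2r h1.
Qed.

(** The distance from 1/2 to the integers is 1/2, and 1/2 - 1/8 = 3/8. *)
Lemma far_int_half (u : R) : near_int (1 / 8) (u - 1 / 2) -> far_int (3 / 8) u.
Proof.
move=> [k]; rewrite ler_norml => /andP[h1 h2] j; rewrite ler_normr.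
by apply/orP; have [h|h] := int_gap j k; [left | right]; lra.
Qed.

(** Ratio 8 leaves two full turns for the choice of each residue, hence 0 and
    1/2 can be prescribed freely. *)
Lemma lacunary8_separated A B : (forall n, A n -> B n -> False) ->
  (forall n, (A `|` B) n -> (0 < n)%N) -> lacunary_set (8 : R) (A `|` B) ->
  trig_sep R A B.
Proof.
move=> AB pos lac8.
pose th n : R := if `[< A n >] then 0 else 1 / 2.
have th01 n : 0 <= th n <= 1 / 2 by rewrite /th; case: asbool; lra.
have [|||n ABn u|be hbe] := @lacunary_dilation R _
    (fun n => [set u | near_int (1 / 8) (u - th n)]) 2 (1 / 4) 8 _ _ _ lac8 pos.
- by [].
- by lra.
- by lra.
- have [k /andP[k1 k2]] := int_above (u + 1 / 8 - th n).
  have := th01 n => /andP[t1 t2].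
  exists (k%:~R + th n - 1 / 8); split; [lra|lra|move=> w /andP[w1 w2] /=].
  by exists k; rewrite ler_norml; apply/andP; split; lra.
apply: (@trig_sep_near_far _ be 0 (1 / 8) (3 / 8)); [lra|lra|lra| |].
  move=> n An; have := hbe n (or_introl An).
  by rewrite /= /th asboolT.
move=> n Bn; have := hbe n (or_intror Bn).
rewrite /= /th asboolF ?subr0; first exact: far_int_half.
by move=> An; exact: AB An Bn.
Qed.

Lemma not_far_int (d u : R) : ~ far_int d u -> exists k : int, `|u - k%:~R| < d.
Proof. by move=> /existsNP[k /negP]; rewrite -ltNge => h; exists k. Qed.

Lemma far_int_close (d e u v : R) :
  far_int (d + e) u -> `|u - v| <= e -> far_int d v.
Proof.
move=> fu uv k; have := fu k; have := ler_normD (u - v) (v - k%:~R).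
by rewrite subrKA; lra.
Qed.

(** If both of rho m and rho (m + 1/32) were close to {0, 1/32} modulo 1, then
    their difference rho / 32 would be close to {-1/32, 0, 1/32} modulo 1; but
    it lies in [q / 32, 1 / 4], where q > 1. *)
Lemma dilate_avoids (q rho d : R) (m : int) :
  0 < d -> 200 * d <= q - 1 -> 200 * d <= 1 -> q <= rho -> rho <= 8 ->
  exists2 c, c = 0 \/ c = 1 / 32 &
    far_int (3 * d) (rho * (m%:~R + c)) /\
    far_int (3 * d) (rho * (m%:~R + c) - 1 / 32).
Proof.
move=> d0 d1 d2 qr r8; apply: contrapT => hN.
have bad c : c = 0 \/ c = 1 / 32 -> exists2 e, e = 0 \/ e = 1 / 32 &
    exists k : int, `|rho * (m%:~R + c) - e - k%:~R| < 3 * d.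
  move=> hc; apply: contrapT => hN'; apply: hN; exists c => //; split.
    apply: contrapT => /not_far_int[k hk]; apply: hN'.
    by exists 0; [left | exists k; rewrite subr0].
  apply: contrapT => /not_far_int[k hk]; apply: hN'.
  by exists (1 / 32); [right | exists k].
have [e0 he0 [k0]] := bad 0 (or_introl erefl).
have [e1 he1 [k1]] := bad _ (or_intror erefl).
rewrite !ltr_norml => /andP[h1 h2] /andP[h3 h4].
have [j1|j1] := int_gap k1 k0.
  have [j2|j2] := int_gap k0 k1;
    case: he0 => ?; case: he1 => ?; subst e0 e1; lra.
case: he0 => ?; case: he1 => ?; subst e0 e1; lra.
Qed.

(** If m in A is the close predecessor of n in B then m * be almost determines
    n * be modulo 1 up to the integer part of m * be, so n * be cannot be
    prescribed as well.  Allowing two residues 0 and 1/32 for m * be suffices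
    to keep n * be away from both, by dilate_avoids. *)
Lemma paired_separated (q : R) : 1 < q -> exists2 W : R, 8 <= W &
  forall A B, lacunary_set W A -> lacunary_set W B ->
  lacunary_set q (A `|` B) ->
  (forall n, A n -> (0 < n)%N) ->
  (forall n, B n -> exists2 m, A m & (m < n <= 8 * m)%N) ->
  trig_sep R A B.
Proof.
move=> q1.
have [d [d0 d1 d2]] : exists d : R, [/\ 0 < d, 200 * d <= q - 1 & 200 * d <= 1].
  have m0 : 0 < Num.min (q - 1) 1 by rewrite lt_min ltr01 andbT; lra.
  have m1 : Num.min (q - 1) 1 <= q - 1 by rewrite ge_min lexx.
  have m2 : Num.min (q - 1) 1 <= 1 by rewrite ge_min lexx orbT.
  by exists (Num.min (q - 1) 1 / 200); split; lra.
have W8 : 8 <= 8 / d by rewrite ler_pdivlMr//; lra.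
exists (8 / d) => // A B lacA lacB lacAB A0 BA.
(* dilating by b / n <= 8 multiplies by at most 8 the radius d / 8 of the
   intervals to be nested, which leaves 2 d of the margin 3 d *)
pose G n := [set u : R | (near_int d u \/ near_int d (u - 1 / 32)) /\
  forall b, B b -> (n < b <= 8 * n)%N ->
    far_int (2 * d) (b%:R / n%:R * u) /\
    far_int (2 * d) (b%:R / n%:R * u - 1 / 32)].
have [|||n An u|be hbe] := @lacunary_dilation R A G
    2 (d / 4) (8 / d) _ _ _ lacA A0.
- by [].
- by lra.
- by have -> : 8 / d * (d / 4) = 2 by field; rewrite gt_eqF.
- have n0 : 0 < n%:R :> R by rewrite ltr0n A0.
  have [k /andP[k1 k2]] := int_above (u + d / 8).
  have near_c c w : k%:~R + c - d / 8 <= w <= k%:~R + c - d / 8 + d / 4 ->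
      near_int d (w - c).
    move=> /andP[w1 w2]; exists k; rewrite ler_norml.
    by apply/andP; split; lra.
  have [[b Bb nb]|nB] := pselect (exists2 b, B b & (n < b <= 8 * n)%N);
    last first.
    exists (k%:~R - d / 8); split; [lra|lra|move=> w hw]; split.
      by left; rewrite -[w]subr0; apply: near_c; rewrite addr0.
    by move=> b Bb nb; case: nB; exists b.
  have b_uniq b' : B b' -> (n < b' <= 8 * n)%N -> b' = b.
    have no_two x y : B x -> B y -> (n < x)%N -> (y <= 8 * n)%N -> ~ (x < y)%N.
      move=> Bx By nx yn xy; have := lacB x y Bx By xy; apply/negP.
      rewrite -ltNge (le_lt_trans (y := 8 * n%:R)) -?natrM ?ler_nat//.
      rewrite natrM (lt_le_trans (y := 8 * x%:R)) ?ltr_pM2l ?ltr_nat//.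
      by rewrite ler_wpM2r ?ler0n.
    case/andP: nb => nb b8 Bb' /andP[nb' b'8].
    have [lt|lt|//] := ltngtP b' b.
      by have := no_two b' b Bb' Bb nb' b8 lt.
    by have := no_two b b' Bb Bb' nb b'8 lt.
  set rho : R := b%:R / n%:R; case/andP: nb => nb b8.
  have qrho : q <= rho.
    by rewrite ler_pdivlMr//; apply: lacAB => //; [left | right].
  have rho8 : rho <= 8 by rewrite ler_pdivrMr// -natrM ler_nat.
  have [c hc [f1 f2]] := dilate_avoids k d0 d1 d2 qrho rho8.
  have c0 : 0 <= c <= 1 / 32 by case: hc => ->; lra.
  have r0 : 0 < rho by lra.
  exists (k%:~R + c - d / 8); split; [lra|lra|move=> w hw]; split.
    by have := near_c c w hw; case: hc => ->; rewrite ?subr0; [left | right].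
  move=> b' Bb' nb'; rewrite (b_uniq b' Bb' nb') -/rho.
  have close : `|rho * (k%:~R + c) - rho * w| <= d.
    rewrite -mulrBr normrM (gtr0_norm r0).
    have : `|k%:~R + c - w| <= d / 8 by rewrite ler_norml; lra.
    by have := normr_ge0 (k%:~R + c - w); nra.
  have d3 : 3 * d = 2 * d + d by ring.
  rewrite d3 in f1 f2; split; first exact: far_int_close f1 close.
  by apply: far_int_close f2 _; rewrite opprD addrACA opprK addNr addr0.
have farB n : B n ->
    far_int (2 * d) (n%:R * be) /\ far_int (2 * d) (n%:R * be - 1 / 32).
  move=> Bn; have [m Am mn] := BA n Bn; have [_] := hbe m Am.
  have m0 : m%:R != 0 :> R by rewrite pnatr_eq0 -lt0n A0.
  have E : n%:R / m%:R * (m%:R * be) = n%:R * be by rewrite mulrA divfK.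
  by move=> /(_ n Bn mn); rewrite E.
pose A0' := [set n | near_int d (n%:R * be)].
pose A1' := [set n | near_int d (n%:R * be - 1 / 32)].
apply: (@trig_sepS _ (A0' `|` A1') B) => //; first by move=> n /hbe[].
apply: trig_sepUl.
  apply: (@trig_sep_near_far _ be 0 d (2 * d)); [lra|lra|lra| |].
    by move=> n; rewrite subr0.
  by move=> n /farB[]; rewrite subr0.
apply: (@trig_sep_near_far _ be (1 / 32) d (2 * d)); [lra|lra|lra| |].
  by [].
by move=> n /farB[].
Qed.

(** The elements of A or B with a close predecessor on the other side are treated
    by paired_separated, in which A and B may be exchanged; between the other
    ones all ratios are at least 8. *)
Lemma sparse_separated (q : R) : 1 < q -> exists2 W : R, 8 <= W &
  forall A B, (forall n, A n -> B n -> False) ->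
  (forall n, (A `|` B) n -> (0 < n)%N) ->
  lacunary_set W A -> lacunary_set W B -> lacunary_set q (A `|` B) ->
  trig_sep R A B.
Proof.
move=> /paired_separated[W W8 pairedW]; exists W => //.
move=> A B AB pos lacA lacB lacAB.
pose A1 := [set n | A n /\ exists2 m, B m & (m < n <= 8 * m)%N].
pose B1 := [set n | B n /\ exists2 m, A m & (m < n <= 8 * m)%N].
have AB1 : trig_sep R A B1.
  apply: pairedW => //; last by move=> n [].
  - by apply: lacunary_setS lacB => n [].
  - by apply: lacunary_setS lacAB => n [|[]]; [left | right].
  - by move=> n An; apply: pos; left.
have BA1 : trig_sep R B A1.
  apply: pairedW => //; last by move=> n [].
  - by apply: lacunary_setS lacA => n [].
  - by apply: lacunary_setS lacAB => n [|[]]; [right | left].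
  - by move=> n Bn; apply: pos; right.
have AB2 : trig_sep R (A `\` A1) (B `\` B1).
  apply: lacunary8_separated.
  - by move=> n [An _] [Bn _]; exact: AB An Bn.
  - by move=> n [[An _]|[Bn _]]; apply: pos; [left | right].
  - move=> x y hx hy xy.
    have wk : W * x%:R <= y%:R -> 8 * x%:R <= y%:R :> R.
      by apply: le_trans; rewrite ler_wpM2r ?ler0n.
    case: hx hy => -[Xx nx] [] [Yy ny].
    + by apply: wk; exact: lacA.
    + rewrite -natrM ler_nat leqNgt; apply/negP => h; apply: ny; split=> //.
      by exists x => //; rewrite xy ltnW.
    + rewrite -natrM ler_nat leqNgt; apply/negP => h; apply: ny; split=> //.
      by exists x => //; rewrite xy ltnW.
    + by apply: wk; exact: lacB.
apply: (@trig_sepS _ (A1 `|` A `\` A1) (B1 `|` B `\` B1)).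
- by move=> n An; have [?|?] := pselect (A1 n); [left | right].
- by move=> n An; have [?|?] := pselect (B1 n); [left | right].
apply: trig_sepUr; first by apply: trig_sepS AB1 => // n [[]|[]].
apply: trig_sepUl => //.
by apply/trig_sep_sym; apply: trig_sepS BA1 => // n [].
Qed.

(** Distinct elements of A or B have distinct integer parts of their logarithm
    in base q, so elements with congruent integer parts modulo a large K.+1
    form a sparse set. *)
Lemma lacunary_separated (q : R) A B : 1 < q ->
  (forall n, A n -> B n -> False) ->
  (forall n, (A `|` B) n -> (0 < n)%N) -> lacunary_set q (A `|` B) ->
  trig_sep R A B.
Proof.
move=> q1 AB pos lacAB.
have [W W8 sepW] := sparse_separated q1.
have lq0 : 0 < ln q by rewrite ln_gt0.
have [K hK] : exists K, W <= q ^+ K.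
  exists (Num.truncn (ln W / ln q)).+1.
  have q0 : 0 < q by lra.
  rewrite -ler_ln ?posrE ?exprn_gt0//; last by lra.
  rewrite lnXn// -mulr_natl -ler_pdivrMr//.
  exact/ltW/truncnS_gt.
have [e eP] : exists e : nat -> nat, forall n, (0 < n)%N ->
    (e n)%:R <= ln (n%:R : R) / ln q < (e n)%:R + 1.
  exists (fun n => Num.truncn (ln (n%:R : R) / ln q)) => n n0.
  by rewrite natr1 truncn_itv// divr_ge0 ?ln_ge0 ?ler1n// ltW.
pose C X i := [set n | X n /\ e n %% K.+1 = i]%N.
have lacC X i : X `<=` A `|` B -> lacunary_set W (C X i).
  move=> sX x y [/sX Xx ex] [/sX Xy ey] xy.
  have x0 : 0 < x%:R :> R by rewrite ltr0n pos.
  have y0 : 0 < y%:R :> R by rewrite ltr0n pos.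
  have q0 : 0 < q by lra.
  have hl : ln (x%:R : R) / ln q + 1 <= ln (y%:R : R) / ln q.
    have -> : ln (x%:R : R) / ln q + 1 = (ln (x%:R : R) + ln q) / ln q.
      by rewrite mulrDl divff// lt0r_neq0.
    rewrite ler_pM2r ?invr_gt0//.
    by rewrite -lnM ?posrE// ler_ln ?posrE ?mulr_gt0// mulrC lacAB.
  have /andP[ex1 ex2] := eP x (pos _ Xx).
  have /andP[ey1 ey2] := eP y (pos _ Xy).
  have exy : (e x < e y)%N by rewrite -(ltr_nat R); lra.
  have exyK : (e x + K.+1 <= e y)%N.
    have dvd_e : (K.+1 %| e y - e x)%N by rewrite -eqn_mod_dvd 1?ltnW// ex ey.
    have dif_gt0 : (0 < e y - e x)%N by rewrite subn_gt0.
    by rewrite -(subnKC (ltnW exy)) leq_add2l dvdn_leq.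
  apply: (@le_trans _ _ (q ^+ K * x%:R)); first by rewrite ler_wpM2r ?ler0n.
  rewrite -ler_ln ?posrE ?mulr_gt0 ?exprn_gt0//.
  rewrite lnM ?posrE ?exprn_gt0// lnXn// -[ln q *+ K]mulr_natl.
  rewrite -(ler_pM2r (x := (ln q)^-1)) ?invr_gt0// mulrDl mulfK ?lt0r_neq0//.
  by move: exyK; rewrite -(ler_nat R) natrD -natr1; lra.
have h i j : trig_sep R (C A i) (C B j).
  apply: sepW.
  - by move=> n [An _] [Bn _]; exact: AB An Bn.
  - by move=> n [[An _]|[Bn _]]; apply: pos; [left | right].
  - by apply: lacC => n; left.
  - by apply: lacC => n; right.
  - by apply: lacunary_setS lacAB => n [[]|[]]; [left | right].
pose s := iota 0 K.+1.
have in_s n : (e n %% K.+1 \in s)%N by rewrite mem_iota ltn_mod.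
apply: (@trig_sepS _ [set n | exists2 i, i \in s & C A i n]
   [set n | exists2 i, i \in s & C B i n]).
- move=> n An.
  exact: (ex_intro2 _ _ (e n %% K.+1)%N (in_s n) (conj An erefl)).
- move=> n An.
  exact: (ex_intro2 _ _ (e n %% K.+1)%N (in_s n) (conj An erefl)).
by apply: trig_sep_bigUl => i; apply: trig_sep_bigUr => j; exact: h.
Qed.

End LacunarySeparation.

(** * Separation inside the set of all r n and r n + t n *)

Section TwoTermSeparation.
Context {R : realType} (r t : nat -> nat) (q : R) (N : nat).
Hypothesis r_gt0 : forall n, (0 < r n)%N.
Hypothesis r_incr : {homo r : m n / (m < n)%N}.
Hypothesis t_incr : {homo t : m n / (m < n)%N}.
Hypothesis q_gt1 : 1 < q.
Hypothesis growth : forall m n, (N <= m)%N -> (m < n)%N ->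
  q * (r m + t m)%:R <= (r n)%:R.

Let E := range r `|` range (fun n => (r n + t n)%N).

Let E_gt0 n : E n -> (0 < n)%N.
Proof. by move=> [] [m _ <-]; rewrite ?addn_gt0 r_gt0. Qed.

Let lt_of_ratio x y : (0 < x)%N -> q * x%:R <= y%:R -> (x < y)%N.
Proof.
move=> x0; rewrite -(ltr_nat R); apply: lt_le_trans.
by rewrite ltr_pMl// ltr0n.
Qed.

(** The sets that contain at most one of r n and r n + t n for each index n, and
    none for n < N, are the images w @` D: they are lacunary. *)
Section Selection.
Variables (w : nat -> nat) (D : set nat).
Hypothesis wE : forall n, w n = r n \/ w n = (r n + t n)%N.
Hypothesis D_ge : forall n, D n -> (N <= n)%N.

Let w_gt0 n : (0 < w n)%N.
Proof. by case: (wE n) => ->; rewrite ?addn_gt0 r_gt0. Qed.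

Let w_growth m n : D m -> (m < n)%N -> q * (w m)%:R <= (w n)%:R.
Proof.
move=> Dm mn; apply: (@le_trans _ _ (r n)%:R); last first.
  by rewrite ler_nat; case: (wE n) => ->; rewrite ?leq_addr.
apply: le_trans (growth (D_ge Dm) mn).
rewrite ler_pM2l ?(lt_trans ltr01)//.
by rewrite ler_nat; case: (wE m) => ->; rewrite ?leq_addr.
Qed.

Lemma selection_lacunary : lacunary_set q (w @` D).
Proof.
move=> _ _ [m Dm <-] [n Dn <-] wmn.
have [mn|nm|mn] := ltngtP m n.
- exact: w_growth.
- have := lt_of_ratio (w_gt0 n) (w_growth Dn nm).
  by rewrite ltnNge ltnW.
- by rewrite mn ltnn in wmn.
Qed.

Lemma selection_inj m n : D m -> D n -> w m = w n -> m = n.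
Proof.
move=> Dm Dn wmn; have [mn|nm|//] := ltngtP m n.
  by have := lt_of_ratio (w_gt0 m) (w_growth Dm mn); rewrite wmn ltnn.
by have := lt_of_ratio (w_gt0 n) (w_growth Dn nm); rewrite wmn ltnn.
Qed.

Lemma selection_separated A B : (forall n, A n -> B n -> False) ->
  A `<=` w @` D -> B `<=` w @` D -> trig_sep R A B.
Proof.
move=> AB sA sB; apply: (lacunary_separated q_gt1) => //.
  by move=> n [/sA|/sB] [m _ <-].
by apply: lacunary_setS selection_lacunary => n [/sA|/sB].
Qed.

(** An integer can be prepended to a lacunary set that starts far enough. *)
Lemma point_selection_separated x B : (0 < x)%N ->
  (forall n, D n -> q * x%:R <= (r n)%:R) -> B `<=` w @` D ->
  trig_sep R [set x] B.
Proof.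
move=> x0 xD sB.
have xB y : B y -> q * x%:R <= y%:R.
  move=> /sB[n Dn <-]; apply: le_trans (xD n Dn) _.
  by rewrite ler_nat; case: (wE n) => ->; rewrite ?leq_addr.
apply: (lacunary_separated q_gt1).
- by move=> n -> Bx; have := lt_of_ratio x0 (xB _ Bx); rewrite ltnn.
- by move=> n [->//|/sB[m _ <-]].
- move=> u v [->|Bu] [->|Bv]; rewrite ?ltnn//.
  + by move=> _; exact: xB.
  + by rewrite ltnNge ltnW// (lt_of_ratio x0 (xB _ Bu)).
  + exact: selection_lacunary (sB _ Bu) (sB _ Bv).
Qed.

End Selection.

Let tail M := [set n | (M <= n)%N].
Let RM M := r @` tail M.
Let TM M := (fun n => r n + t n)%N @` tail M.

(** The elements of index at least M, together with finitely many singletons,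
    exhaust E. *)
Let E_split M B : B `<=` E ->
  B `<=` [set n | exists2 i, i \in iota 0 (r M + t M) & i = n /\ B n] `|`
    ((B `&` RM M) `|` (B `&` TM M)).
Proof.
move=> sB n Bn; case: (sB _ Bn) => -[m _ mn].
  have [Mm|mM] := leqP M m; first by right; left; split => //; exists m.
  left; exists n => //; rewrite mem_iota add0n leq0n/= -mn.
  by apply: ltn_addr; exact: r_incr.
have [Mm|mM] := leqP M m; first by right; right; split => //; exists m.
left; exists n => //; rewrite mem_iota add0n leq0n/= -mn -addSn.
by apply: leq_add; [exact: r_incr | exact/ltnW/t_incr].
Qed.

Let leq_r n : (n <= r n)%N.
Proof. by elim: n => // n IH; apply: leq_ltn_trans IH _; exact: r_incr. Qed.

Lemma point_separated x B : E x -> B `<=` E -> ~ B x -> trig_sep R [set x] B.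
Proof.
move=> /E_gt0 x0 sB nBx.
pose M := (N + (Num.truncn (q * x%:R)).+1)%N.
have NM : (N <= M)%N by rewrite leq_addr.
have xM n : (M <= n)%N -> q * x%:R <= (r n)%:R.
  move=> Mn; apply: (@le_trans _ _ M%:R); last first.
    by rewrite ler_nat (leq_trans Mn (leq_r n)).
  rewrite /M natrD ler_wpDl//; exact/ltW/truncnS_gt.
apply: (trig_sepS (@subset_refl _ [set x]) (E_split M sB)).
have tailN n : tail M n -> (N <= n)%N by exact: leq_trans.
apply: trig_sepUr; last apply: trig_sepUr.
- apply: trig_sep_bigUr => y; have [By|nBy] := pselect (B y); last first.
    by apply: trig_sepS (trig_sep_set0 [set x]) => // n [<-].
  apply: (@trig_sepS _ [set x] [set y]) => //; first by move=> n [->].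
  have y0 := E_gt0 (sB _ By).
  have pt u v : (0 < u)%N -> (u < v)%N -> trig_sep R [set u] [set v].
    move=> u0 uv; have u0' : 0 < u%:R :> R by rewrite ltr0n.
    apply: (@lacunary_separated _ (v%:R / u%:R)).
    - by rewrite ltr_pdivlMr// mul1r ltr_nat.
    - by move=> n /= -> uv'; rewrite uv' ltnn in uv.
    - by move=> n [] ->//; exact: ltn_trans uv.
    - move=> m n [] -> [] ->; rewrite ?ltnn//.
        by rewrite divfK ?gt_eqF.
      by rewrite ltnNge ltnW.
  have [xy|yx|xy] := ltngtP x y; [exact: pt|exact/trig_sep_sym/pt|].
  by rewrite xy in nBx.
- apply: (@point_selection_separated r (tail M)) => //.
  by move=> n; left.
- apply: (@point_selection_separated (fun n => r n + t n)%N (tail M)) => //.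
  by move=> n; right.
Qed.

(** An element r m + t m is attached to a pair (j, p), where a j witnesses
    that t m is not Bohr-small and the residue of r m * a j modulo 1 lies near
    p / K.  The r n with the same residue are then separated from r m + t m by
    a j; the other ones form with the r m + t m a lacunary set. *)
Lemma shift_separated d (a : 'I_d -> R) (e : R) : 0 < e ->
  (forall n, exists j, far_int e ((t n)%:R * a j)) ->
  trig_sep R (RM N) (TM N).
Proof.
move=> e0 far_t.
pose K := (Num.truncn (2 / e) + 3)%N.
have K0 : 0 < K%:R :> R by rewrite ltr0n /K addn_gt0 orbT.
have K3 : K%:R^-1 <= 3^-1 :> R by rewrite lef_pV2 ?posrE// ler_nat /K leq_addl.
have Ke : 2 * K%:R^-1 < e.
  rewrite ltr_pdivrMr// -ltr_pdivrMl// mulrC.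
  apply: lt_le_trans (truncnS_gt _) _; rewrite ler_nat /K -addn1.
  by rewrite leq_add2l.
pose box (p : nat) (x : R) := near_int K%:R^-1 (x - p%:R / K%:R).
have box_ex x : exists2 p, p \in iota 0 K & box p x.
  pose f := x - (Num.floor x)%:~R.
  have /andP[f0 f1] := floor_itv x; rewrite intrD in f1.
  have Kf : 0 <= f * K%:R by rewrite mulr_ge0 ?(ltW K0)// /f; lra.
  have /andP[] := truncn_itv Kf; rewrite -natr1.
  have : (Num.truncn (f * K%:R) < K)%N.
    by rewrite truncn_lt_nat// gtr_pMl// /f; lra.
  move: (Num.truncn _) => p pK p1 p2.
  exists p; first by rewrite mem_iota leq0n add0n.
  exists (Num.floor x); rewrite addrAC -/f.
  rewrite -[f](mulfK (lt0r_neq0 K0)) -mulrBl normrM normfV (gtr0_norm K0).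
  rewrite ler_piMl ?invr_ge0 ?(ltW K0)// ler_norml.
  by apply/andP; split; lra.
pose T1 j p := [set n | exists2 m, (N <= m)%N &
  [/\ n = (r m + t m)%N, far_int e ((t m)%:R * a j) & box p ((r m)%:R * a j)]].
apply: (@trig_sepS _ (RM N) [set n | exists2 j, j \in enum 'I_d &
  [set n | exists2 p, p \in iota 0 K & T1 j p n] n]) => //.
  move=> _ [m Nm <-]; have [j jm] := far_t m.
  exists j; first by rewrite mem_enum.
  by have [p pK pm] := box_ex ((r m)%:R * a j); exists p => //; exists m.
apply: trig_sep_bigUr => j; apply: trig_sep_bigUr => p.
pose U := [set n | box p ((r n)%:R * a j)].
apply: (@trig_sepS _ ([set n | box p (n%:R * a j)] `|` r @` (tail N `&` ~` U))
    (T1 j p)) => //.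
  move=> _ [n Nn <-]; have [Un|nUn] := pselect (U n); first by left.
  by right; exists n.
apply: trig_sepUl.
  apply: (@trig_sep_near_far _ (a j) (p%:R / K%:R) K%:R^-1 (e - K%:R^-1)).
  - by rewrite invr_ge0 ltW.
  - lra.
  - lra.
  - by [].
  move=> _ [m Nm [-> ft [k hk]]] l.
  have := ft (l - k).
  have := ler_normD ((r m + t m)%:R * a j - p%:R / K%:R - l%:~R)
     (- ((r m)%:R * a j - p%:R / K%:R - k%:~R)).
  rewrite normrN.
  have -> : (r m + t m)%:R * a j - p%:R / K%:R - l%:~R -
      ((r m)%:R * a j - p%:R / K%:R - k%:~R) = (t m)%:R * a j - (l - k)%:~R.
    by rewrite natrD intrB; ring.
  lra.
pose w n := if `[< U n >] then (r n + t n)%N else r n.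
have wE n : w n = r n \/ w n = (r n + t n)%N.
  by rewrite /w; case: asbool; [right | left].
have wU n : U n -> w n = (r n + t n)%N by rewrite /w => /asboolT ->.
have wnU n : ~ U n -> w n = r n by rewrite /w => /asboolF ->.
apply: (@selection_separated w (tail N)) => //.
- move=> _ [n [Nn nUn] <-] [m Nm [+ _ Um]].
  rewrite -(wnU _ nUn) -(wU m Um) => wnm; apply: nUn.
  by rewrite (@selection_inj w (tail N) wE _ n m Nn Nm wnm).
- by move=> _ [n [Nn nUn] <-]; exists n => //; exact: wnU.
- by move=> _ [m Nm [-> _ Um]]; exists m => //; exact: wU.
Qed.

(** The singletons are handled by point_separated and, among the tails, only the
    r n and the r n + t n are not part of a common lacunary set. *)
Lemma two_term_separated d (a : 'I_d -> R) (e : R) A B : 0 < e ->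
  (forall n, exists j, far_int e ((t n)%:R * a j)) ->
  A `<=` E -> B `<=` E -> (forall n, A n -> B n -> False) -> trig_sep R A B.
Proof.
move=> e0 far_t sA sB AB.
have sep_RT := shift_separated e0 far_t.
apply: (trig_sepS (E_split N sA) (@subset_refl _ B)).
apply: trig_sepUl.
  apply: trig_sep_bigUl => x; have [Ax|nAx] := pselect (A x); last first.
    apply/trig_sep_sym.
    by apply: trig_sepS (trig_sep_set0 B) => // n [<-].
  apply: (@trig_sepS _ [set x] B) => //; first by move=> n [->].
  by apply: point_separated => //; [exact: sA | exact: AB].
apply: (trig_sepS (@subset_refl _ _) (E_split N sB)); apply: trig_sepUr.
  apply: trig_sep_bigUr => x; have [Bx|nBx] := pselect (B x); last first.
    by apply: trig_sepS (trig_sep_set0 setT) => // n [<-].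
  apply: (@trig_sepS _ A [set x]); first by move=> n [] [].
    by move=> n [->].
  apply/trig_sep_sym; apply: point_separated => //; first exact: sB.
  by move=> /AB; exact.
have tailN n : tail N n -> (N <= n)%N by [].
have AB' X Y n : (A `&` X) n -> (B `&` Y) n -> False.
  by move=> [An _] [Bn _]; exact: AB An Bn.
apply: trig_sepUl; apply: trig_sepUr.
- apply: (@selection_separated r (tail N) _ tailN _ _ (@AB' _ _)) => //.
  by move=> n; left.
- by apply: trig_sepS sep_RT => n [].
- by apply/trig_sep_sym; apply: trig_sepS sep_RT => n [].
- apply: (@selection_separated (fun n => r n + t n)%N
    _ _ tailN _ _ (@AB' _ _)) => //.
  by move=> n; right.
Qed.

End TwoTermSeparation.

(** * Bohr recurrence in terms of real frequencies *)

Section BohrRecurrence.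
Context {R : realType}.

Let tpi (x : R) : torus R := (\pi_(Quotient.quot (integers R)) x)%qT.

Let tpiMn x n : tpi (x *+ n) = tpi x *+ n.
Proof.
elim: n => [|n IH].
  rewrite !mulr0n /tpi -[RHS]/(Quotient.zero (integers R)).
  by unlock Quotient.zero.
rewrite !mulrS -IH /tpi.
exact: (Quotient.pi_add (integers R)).
Qed.

Let tpiE x y : tpi x = tpi y <-> exists k : int, x = y + k%:~R.
Proof.
split=> [xy|[k ->]].
  have /intrP[k xyk] : x - y \in integers R.
    by rewrite Quotient.idealrBE; apply/eqP; exact: xy.
  by exists k; rewrite -xyk addrC subrK.
have : y + k%:~R - y \in integers R.
  by apply/intrP; exists k; rewrite addrAC subrr add0r.
by rewrite Quotient.idealrBE => /eqP.
Qed.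

(** The topology of the torus is that of the distance to the nearest integer of
    real representatives. *)
Lemma bohr_recurrentP (S : set nat) : bohr_recurrent R S <->
  forall d (a : 'I_d -> R) (e : R), 0 < e ->
  exists2 n, S n & forall j, exists k : int, `|n%:R * a j - k%:~R| < e.
Proof.
split=> [recS d a e e0|recS d alpha B].
  pose V : set (torus R) := tpi @` [set y | exists k : int, `|y - k%:~R| < e].
  have VE y : V (tpi y) -> exists k : int, `|y - k%:~R| < e.
    move=> [z [k zk] /tpiE[l zyl]]; exists (k - l).
    by rewrite intrB (_ : y - _ = z - k%:~R)// zyl; ring.
  have V0 : nbhs (0 : torus R) V.
    apply: open_nbhs_nbhs; split; last first.
      by exists 0; [exists 0; rewrite subr0 normr0 | exact: (tpiMn 0 0)].
    rewrite /open /= /quotient_open.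
    have -> : (\pi_(torus R)%qT @^-1` V) =
        \bigcup_(k : int) ball (k%:~R : R) e.
      apply/seteqP; split=> y /=.
        by move=> /VE[k yk]; exists k => //; rewrite /ball /= distrC.
      by move=> [k _]; rewrite /ball /= distrC => yk; exists y => //; exists k.
    by apply: bigcup_open => k _; exact: ball_open.
  pose al : 'rV[torus R]_d := \row_j tpi (a j).
  have [|_ [[n Sn <-] hn]] := recS d al [set M | forall i j, V (M i j)].
    exists (fun _ _ => V) => // i j; rewrite mxE; exact: V0.
  exists n => // j; apply: VE.
  by have := hn ord0 j; rewrite mulmxnE mxE -tpiMn mulr_natl.
move=> [P P0 sPB].
pose a j := repr (alpha ord0 j).
have aE j : tpi (a j) = alpha ord0 j by exact: reprK.
have P0a j : nbhs (0 : R) [set y | P ord0 j (tpi y)].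
  apply: (@pi_continuous _ (Quotient.quot (integers R))).
  have := P0 ord0 j; rewrite mxE.
  by have -> : (0 : torus R) = tpi 0 by exact: (esym (tpiMn 0 0)).
have /nbhs_ballP[e /= e0 he] := filter_forall (nbhs_filter (0 : R)) P0a.
have [n Sn hn] := recS d a e e0.
exists (alpha *+ n); split; first by exists n.
apply: sPB => i j; rewrite ord1 mulmxnE -aE -tpiMn.
have [k nak] := hn j.
have -> : tpi (a j *+ n) = tpi (n%:R * a j - k%:~R).
  by apply/tpiE; exists k; rewrite subrK mulr_natl.
apply: he; by rewrite /ball /= sub0r normrN.
Qed.

End BohrRecurrence.

(** * From separation to interpolation *)

Section Interpolation.
Context {R : realType}.

Lemma uniform_cvgP (A : set nat) (p : nat -> nat -> R[i]^o)
    (f : nat -> R[i]^o) :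
  {uniform A, p @ \oo --> f} <->
  forall e : R, 0 < e ->
    \forall k \near \oo, forall n, A n -> `|f n - p k n| < e%:C%C.
Proof.
split=> [pf e e0|h P].
  apply: (pf [set h : nat -> R[i]^o | forall n, A n -> `|f n - h n| < e%:C%C]).
  apply/uniform_nbhs.
  exists [set xy : R[i]^o * R[i]^o | ball xy.1 e%:C%C xy.2]; split; last first.
    by move=> h hh n An; exact: hh.
  rewrite -entourage_ballE; exists e%:C%C; last by [].
  by rewrite /= ltcR.
move=> fP; have [W [entW sW]] := iffLR (uniform_nbhs _ _) fP.
move: entW; rewrite -entourage_ballE => -[eps /= eps0 sE].
have epsE : eps = (complex.Re eps)%:C%C.
  by rewrite RRe_real// gtr0_real.
have e0 : 0 < complex.Re eps by rewrite -ltcR -epsE.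
have := h _ e0; apply: filterS => k hk; apply: sW => n An.
by apply: sE; rewrite /ball /= epsE; exact: hk.
Qed.

Section Real.
Variable E : set nat.
Hypothesis E_sep : forall A B, A `<=` E -> B `<=` E ->
  (forall n, A n -> B n -> False) -> trig_sep R A B.

(** Where f is at most - M / 3 or at least M / 3, a correction of the same sign
    and of size between M / 6 and M / 3 reduces it; elsewhere a correction of
    size at most M / 3 leaves at most 2 M / 3. *)
Lemma interpolation_step (f : nat -> R) (M : R) : 0 <= M ->
  (forall n, E n -> `|f n| <= M) ->
  exists P, [/\ real_trig_poly P, forall n, `|P n| <= M / 3 &
    forall n, E n -> `|f n - P n| <= 5 / 6 * M].
Proof.
move=> M0 fM.
have [M00|M_neq0] := eqVneq M 0.
  exists (fun=> 0); split; first exact: rtrigpC.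
    by move=> n; rewrite normr0 divr_ge0.
  by move=> n /fM; rewrite M00 mulr0 subr0.
have Mgt0 : 0 < M by rewrite lt0r M_neq0.
have sepAB : trig_sep R [set n | E n /\ f n <= - (M / 3)]
    [set n | E n /\ M / 3 <= f n].
  apply: E_sep; [by move=> n []|by move=> n []|].
  by move=> n /= [_ h1] [_ h2]; lra.
have [P [hP P01 PA PB]] := trig_sep_amplify sepAB.
exists (fun n => M / 3 * (2 * P n + - 1)); split.
- apply: rtrigpM; first exact: rtrigpC.
  apply: rtrigpD; last exact: rtrigpC.
  by apply: rtrigpM => //; exact: rtrigpC.
- move=> n; rewrite ler_norml; have /andP[h1 h2] := P01 n.
  by apply/andP; split; nra.
move=> n En; have := fM n En; rewrite !ler_norml => /andP[f1 f2].
have /andP[h1 h2] := P01 n.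
have [hA|hA] := leP (f n) (- (M / 3)).
  by have := PA n (conj En hA) => hP'; apply/andP; split; nra.
have [hB|hB] := leP (M / 3) (f n).
  by have := PB n (conj En hB) => hP'; apply/andP; split; nra.
by apply/andP; split; nra.
Qed.

(** Tietze's argument: the error of interpolation_step is interpolated again,
    and the corrections decrease geometrically on all of nat. *)
Lemma real_interpolation (f : nat -> R) (M : R) : 0 <= M ->
  (forall n, E n -> `|f n| <= M) ->
  exists (s : nat -> nat -> R) (g : nat -> R),
    [/\ forall k, real_trig_poly (s k),
        forall k n, `|g n - s k n| <= 2 * M * (5 / 6) ^+ k &
        forall n, E n -> g n = f n].
Proof.
move=> M0 fM; pose c : R := 5 / 6.
have c0 k : 0 <= c ^+ k * M by rewrite mulr_ge0// exprn_ge0// /c; lra.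
have /boolp.choice[pick pickP] : forall hM : (nat -> R) * R, exists P,
    0 <= hM.2 -> (forall n, E n -> `|hM.1 n| <= hM.2) ->
    [/\ real_trig_poly P, forall n, `|P n| <= hM.2 / 3 &
      forall n, E n -> `|hM.1 n - P n| <= c * hM.2].
  move=> [h K] /=; have [K0|nK0] := pselect (0 <= K); last by exists (fun=> 0).
  have [hK|nhK] := pselect (forall n, E n -> `|h n| <= K);
    last by exists (fun=> 0).
  by have [P hP] := interpolation_step K0 hK; exists P.
pose s := fix s k := if k is m.+1
  then (fun n => s m n + pick ((fun n => f n - s m n), c ^+ m * M) n)
  else (fun=> 0) : nat -> R.
have sE k n : E n -> `|f n - s k n| <= c ^+ k * M.
  elim: k n => [|k IH] n En /=; first by rewrite subr0 mul1r fM.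
  have [_ _ /(_ n En)] := pickP (_, _) (c0 k) IH.
  by rewrite /= opprD addrA exprS mulrA.
have s_trig k : real_trig_poly (s k).
  elim: k => [|k IH] /=; first exact: rtrigpC.
  by apply: rtrigpD => //; have [] := pickP (_, _) (c0 k) (sE k).
have s_step k n : `|s k.+1 n - s k n| <= c ^+ k * M / 3.
  have [_ h _] := pickP (_, _) (c0 k) (sE k).
  by rewrite /= addrAC subrr add0r; exact: h.
have /boolp.choice[g0 g0P] : forall n, exists x,
    forall k, s k n - 2 * M * c ^+ k <= x <= s k n + 2 * M * c ^+ k.
  move=> n; apply: nested_intervals_point => k.
  - have := s_step k n; rewrite ler_norml exprS => /andP[h1 h2].
    by rewrite /c; rewrite /c in h1 h2; lra.
  - have := s_step k n; rewrite ler_norml exprS => /andP[h1 h2].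
    by rewrite /c; rewrite /c in h1 h2; lra.
  - by have := c0 k; lra.
exists s, (fun n => if `[< E n >] then f n else g0 n); split => // [k n|n En].
  case: asboolP => [En|_].
    by apply: le_trans (sE k n En) _; have := c0 k; rewrite -/c; lra.
  by have := g0P n k; rewrite ler_norml -/c; lra.
by rewrite asboolT.
Qed.

End Real.

Lemma normc_le (z : R[i]) : `|z| <= (`|complex.Re z| + `|complex.Im z|)%:C%C.
Proof.
case: z => x y /=; have -> : (x +i* y)%C = x%:C%C + 'i%C * y%:C%C.
  by simpc.
rewrite (le_trans (ler_normD _ _))// normrM rmorphD /= lerD//.
  by rewrite normc_def /= expr0n addr0 sqrtr_sqr.
by rewrite !normc_def /= !expr0n !add0r !addr0 expr1n sqrtr1 mul1r sqrtr_sqr.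
Qed.

Lemma normc_ge_Im (z : R[i]) : `|complex.Im z|%:C%C <= `|z|.
Proof.
case: z => x y; rewrite normc_def lecR /= -[leLHS]sqrtr_sqr.
by rewrite ler_wsqrtr// lerDr sqr_ge0.
Qed.

Lemma I0_of_separated (E : set nat) :
  (forall A B, A `<=` E -> B `<=` E -> (forall n, A n -> B n -> False) ->
    trig_sep R A B) -> I0_set R E.
Proof.
move=> E_sep f [M0 [M0r bf]].
have [M M_ge0 fM] : exists2 M : R, 0 <= M & forall n, E n -> `|f n| <= M%:C%C.
  have [m mE] : exists m : R, M0 = m%:C%C by apply/complex_realP.
  exists (Num.max m 0 + 1); first by rewrite addr_ge0// le_max lexx orbT.
  apply: bf; rewrite mE ltcR.
  by rewrite ltr_pwDr// le_max lexx.
have reM n : E n -> `|complex.Re (f n)| <= M.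
  by move=> /fM h; rewrite -lecR; apply: le_trans (normc_ge_Re _) h.
have imM n : E n -> `|complex.Im (f n)| <= M.
  by move=> /fM h; rewrite -lecR; apply: le_trans (normc_ge_Im _) h.
have [s1 [g1 [s1t s1g g1f]]] := real_interpolation E_sep M_ge0 reM.
have [s2 [g2 [s2t s2g g2f]]] := real_interpolation E_sep M_ge0 imM.
exists (fun n => (g1 n +i* g2 n)%C : R[i]^o); split; last first.
  by move=> n En; rewrite g1f// g2f//; case: (f n).
exists (fun k n => (s1 k n)%:C%C + 'i%C * (s2 k n)%:C%C : R[i]^o); split.
  move=> k; apply: trigpD; first exact: s1t.
  by apply: trigpM; [exact: trigpC | exact: s2t].
apply/uniform_cvgP => e e0.
have small : \forall k \near \oo, 4 * M * (5 / 6) ^+ k < e.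
  have : (fun k => 4 * M * (5 / 6) ^+ k) @ \oo --> (4 * M * 0 : R).
    by apply: cvgMr; apply: cvg_expr; rewrite ger0_norm; lra.
  rewrite mulr0 => /cvgr_lt; exact.
apply: filterS small => k ke n _.
apply: le_lt_trans (normc_le _) _; rewrite ltcR.
have -> : (g1 n +i* g2 n)%C - ((s1 k n)%:C%C + 'i%C * (s2 k n)%:C%C) =
    ((g1 n - s1 k n) +i* (g2 n - s2 k n))%C by simpc.
have := s1g k n; have := s2g k n; move=> /= h1 h2.
lra.
Qed.

End Interpolation.

(** * Almost periods, and the equivalence *)

Section AlmostPeriods.
Context {R : realType}.

Lemma expi_near1 (e : R) : 0 < e -> exists2 d : R, 0 < d &
  forall x, near_int d x -> `|expi (2 * pi * x) - 1| <= e%:C%C.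
Proof.
move=> e0; have p0 := pi_gt0 R.
have : \forall x \near (0 : R), 1 - e ^+ 2 / 2 < cos x.
  have := @continuous_cos R 0; rewrite /continuous_at cos0 => /cvgr_gt; apply.
  by rewrite ltrBlDr ltrDl divr_gt0// exprn_gt0.
move=> /nbhs_ballP[b /= b0 hb].
pose d := Num.min (b / (4 * pi)) 2^-1.
have d0 : 0 < d by rewrite lt_min invr_gt0 ltr0n andbT divr_gt0// mulr_gt0.
have d2 : d <= 2^-1 by rewrite ge_min lexx orbT.
have db : 2 * pi * d < b.
  have : d <= b / (4 * pi) by rewrite ge_min lexx.
  by rewrite ler_pdivlMr ?mulr_gt0//; lra.
exists d => // x /(near_int_cos d2) cos_x.
have cos_d : 1 - e ^+ 2 / 2 < cos (2 * pi * d).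
  apply: hb; rewrite /ball /= sub0r normrN gtr0_norm//.
  by rewrite !mulr_gt0.
rewrite normc_def lecR /= oppr0 addr0.
rewrite -[X in _ <= X](gtr0_norm e0) -[X in _ <= X]sqrtr_sqr ler_wsqrtr//.
have := cos2Dsin2 (2 * pi * x).
set C := cos (2 * pi * x) in cos_x *; set s := sin _ => cs.
have -> : (C - 1) ^+ 2 + s ^+ 2 = (C ^+ 2 + s ^+ 2) + 1 - 2 * C by ring.
by rewrite cs; lra.
Qed.

(** A set of Bohr recurrence provides arbitrarily large almost periods of a
    trigonometric polynomial: an additional frequency 1 / N.+1 makes the return
    times that are at most N stay away from 0 modulo 1. *)
Lemma trig_poly_recurrent (S : set nat) (p : nat -> R[i]^o) (e : R) (N : nat) :
  (forall n, S n -> (0 < n)%N) ->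
  bohr_recurrent R S -> trigonometric_polynomial p -> 0 < e ->
  exists2 s, S s & (N < s)%N /\ forall n, `|p (n + s)%N - p n| <= e%:C%C.
Proof.
move=> S0 /bohr_recurrentP recS [k [c [alpha pE]]] e0.
pose C := \sum_(j < k) complex.Re `|c j|.
have C0 : 0 <= C.
  by apply: sumr_ge0 => j _; rewrite normc_def /= sqrtr_ge0.
have CE : \sum_(j < k) `|c j| = C%:C%C.
  by rewrite rmorph_sum; apply: eq_bigr => j _; rewrite normc_def.
have [|d d0 hd] := @expi_near1 (e / (1 + C)); first by rewrite divr_gt0//; lra.
have [v v0 vN] : exists2 v : R, 0 < v & v * N.+1%:R = 1.
  by exists N.+1%:R^-1; [rewrite invr_gt0 ltr0n | rewrite mulVf// pnatr_eq0].
pose a (i : 'I_k.+1) := oapp alpha v (unlift ord_max i).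
have [|s Ss hs] := recS _ a (Num.min d v); first by rewrite lt_min d0.
exists s => //; split.
  have [m] := hs ord_max; rewrite /a unlift_none /= lt_min => /andP[_].
  rewrite ltr_norml => /andP[h1 h2].
  have s1 : v <= s%:R * v by rewrite ler_peMl ?(ltW v0)// ler1n S0.
  have [m0|m1] := @int_gap R m 0; first by rewrite mulr0z in m0; lra.
  rewrite mulr0z add0r in m1.
  have : 1 * N.+1%:R < (s%:R + 1) * v * N.+1%:R :> R.
    by rewrite ltr_pM2r ?ltr0n//; lra.
  by rewrite mul1r -mulrA vN mulr1 natr1 ltr_nat.
move=> n; rewrite !pE -sumrB; apply: le_trans (ler_norm_sum _ _ _) _.
apply: (@le_trans _ _ (\sum_(j < k) `|c j| * (e / (1 + C))%:C%C)).
  apply: ler_sum => j _.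
  have -> : 2 * pi * (n + s)%:R * alpha j =
      2 * pi * n%:R * alpha j + 2 * pi * (s%:R * alpha j).
    by rewrite natrD; ring.
  rewrite expiD -mulrBr -[X in _ - X]mulr1 -mulrBr !normrM norm_expi mul1r.
  apply: ler_wpM2l => //; apply: hd.
  have [m] := hs (lift ord_max j); rewrite /a liftK /= lt_min => /andP[+ _].
  by move=> /ltW h; exists m.
rewrite -mulr_suml CE -rmorphM /= lecR mulrCA ger_pMr//.
by rewrite ler_pdivrMr; lra.
Qed.

End AlmostPeriods.

Section Main.
Context {R : realType} (r t : nat -> nat).
Hypothesis r_gt0 : forall n, (0 < r n)%N.
Hypothesis r_lacunary : lacunary R r.
Hypothesis t_gt0 : forall n, (0 < t n)%N.
Hypothesis t_incr : {homo t : m n / (m < n)%N}.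
Hypothesis t_over_r : (t n)%:R / (r n)%:R @[n --> \oo] --> (0 : R).

(** A ratio q below the lacunarity ratio of r leaves room to absorb t m, which
    is eventually small against r m. *)
Lemma eventual_growth : exists q N, 1 < q :> R /\
  forall m n, (N <= m)%N -> (m < n)%N -> q * (r m + t m)%:R <= (r n)%:R :> R.
Proof.
have [r_incr q0_gt1] := r_lacunary.
set q0 := inf _ in q0_gt1.
have r0 n : 0 < (r n)%:R :> R by rewrite ltr0n.
have r_step n : q0 * (r n)%:R <= (r n.+1)%:R.
  rewrite -ler_pdivlMr//; apply: ge_inf; last by exists n.
  by exists 0 => _ [m _ <-]; rewrite divr_ge0.
pose e := (q0 - 1) / 2; have e0 : 0 < e by rewrite /e; lra.
have [N _ tN] : \forall n \near \oo, (t n)%:R / (r n)%:R < e.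
  by move/cvgr_lt: t_over_r; exact.
exists (q0 / (1 + e)), N; split.
  by rewrite ltr_pdivlMr /e; lra.
move=> m n Nm mn.
have rmn : q0 * (r m)%:R <= (r n)%:R.
  apply: le_trans (r_step m) _; rewrite ler_nat.
  by rewrite leq_eqVlt in mn; case/predU1P: mn => [->//|/r_incr/ltnW].
apply: le_trans rmn; rewrite mulrAC ler_pdivrMr; last by lra.
rewrite -mulrA ler_pM2l; last by lra.
have := tN m Nm; rewrite ltr_pdivrMr// natrD; lra.
Qed.

Lemma I0_of_not_recurrent : ~ bohr_recurrent R (range t) ->
  I0_set R (range r `|` range (fun n => (r n + t n)%N)).
Proof.
move=> not_rec; have [q [N [q1 growth]]] := eventual_growth.
have [r_incr _] := r_lacunary.
have [d [a [e [e0 far_t]]]] : exists d (a : 'I_d -> R) e, 0 < e /\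
    forall n, exists j, far_int e ((t n)%:R * a j).
  apply: contrapT => hN; apply/not_rec/bohr_recurrentP => d a e e0.
  apply: contrapT => hN'; apply: hN; exists d, a, e; split=> // n.
  apply: contrapT => hN; apply: hN'; exists (t n); first by exists n.
  move=> j; apply: contrapT => hN'; apply: hN; exists j => k.
  by rewrite leNgt; apply/negP => h; apply: hN'; exists k.
apply: I0_of_separated => A B sA sB AB.
exact: (two_term_separated r_gt0 r_incr t_incr q1 growth e0 far_t sA sB AB).
Qed.

(** The function that is 1 at r n + t n for n >= N, and 0 at the other elements
    of E, has no almost periodic extension. *)
Lemma not_recurrent_of_I0 :
  I0_set R (range r `|` range (fun n => (r n + t n)%N)) ->
  ~ bohr_recurrent R (range t).
Proof.
move=> I0E rec_t; have [q [N [q1 growth]]] := eventual_growth.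
have [r_incr _] := r_lacunary.
pose T := [set n | exists2 m, (N <= m)%N & n = (r m + t m)%N].
pose f n : R[i]^o := if `[< T n >] then 1 else 0.
have r_notin_T m : ~ T (r m).
  move=> [m' Nm' rE]; have [mm'|m'm] := leqP m m'.
    have : (r m <= r m')%N.
      by move: mm'; rewrite leq_eqVlt => /predU1P[->//|/r_incr/ltnW].
    by rewrite rE leqNgt -[X in (X < _)%N]addn0 ltn_add2l t_gt0.
  have := growth m' m Nm' m'm; rewrite -rE leNgt.
  by rewrite ltr_pMl ?ltr0n ?r_gt0// q1.
have [|g [[p [p_trig p_cvg]] gf]] := I0E f.
  exists 1; split; first exact: real1.
  move=> M M1 n _ /=; apply: le_trans (ltW M1).
  by rewrite /f; case: asbool; rewrite ?normr1 ?normr0 ?ler01.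
have [|K _ pK] := (uniform_cvgP _ _ _).1 p_cvg (1 / 4); first by lra.
have {}pK := pK K (leqnn K).
have [||_ [m _ <-] [tN hp]] := @trig_poly_recurrent R (range t) (p K)
  (1 / 4) (t N) _ rec_t (p_trig K) _.
- by move=> _ [m _ <-].
- by lra.
have Nm : (N <= m)%N.
  rewrite leqNgt; apply/negP => /t_incr; rewrite ltnNge ltnW//.
have gr : g (r m) = 0.
  by rewrite gf ?/f ?asboolF//; left; exists m.
have grt : g (r m + t m)%N = 1.
  rewrite gf; last by right; exists m.
  by rewrite /f asboolT//; exists m.
have h1 := pK (r m) (r_gt0 m); have h2 := pK (r m + t m)%N _.
have {}h2 := h2 (ltn_addr _ (r_gt0 m)).
have h3 := hp (r m).
rewrite gr in h1; rewrite grt in h2.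
have : `|1 : R[i]| < (3 / 4)%:C%C.
  have -> : (1 : R[i]) = (1 - p K (r m + t m)%N) + (p K (r m + t m)%N - p K (r m))
     - (0 - p K (r m)) by ring.
  have -> : 3 / 4 = 1 / 4 + 1 / 4 + 1 / 4 :> R by lra.
  rewrite !rmorphD /=; apply: le_lt_trans (ler_normB _ _) _.
  rewrite ltrD//; apply: le_lt_trans (ler_normD _ _) _.
  by rewrite ltr_leD.
rewrite normr1 ltcR; lra.
Qed.

End Main.

Theorem proposition1p4 (R : realType) (r t : nat -> nat)
    (r_gt0 : forall n, (0 < r n)%N) (r_lacunary : lacunary R r)
    (t_gt0 : forall n, (0 < t n)%N) (t_incr : {homo t : m n / (m < n)%N})
    (t_over_r : (t n)%:R / (r n)%:R @[n --> \oo] --> (0 : R)) :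
  I0_set R (range r `|` range (fun n => (r n + t n)%N)) <->
  ~ bohr_recurrent R (range t).
Proof.
split; first exact: not_recurrent_of_I0.
exact: I0_of_not_recurrent.
Qed.
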